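(* Let $p\ge 1$ and let $S\subset \mathbb{N}^p$ be an affine semigroup minimally generated by the set $\{s_1,\ldots,s_t\}$. Let $i\in\{1,\ldots,t\}$ and let $S'$ be the semigroup (submonoid of $\mathbb{N}^p$) generated by $$\{s_1,\ldots ,s_{i-1},s_{i+1},\ldots ,s_t,2s_i,3s_i\}\cup \{s_i+s_j \mid j\in \{1,\ldots,t\}\setminus \{i\}\}.$$ Then the following hold: (1) $S'=S\setminus\{s_i\}$; (2) the elements of $G=\{s_1,\ldots ,s_{i-1},s_{i+1},\ldots ,s_t\}$ are minimal generators of $S'$, i.e. they belong to the minimal generating set of $S'$.
   Context: $\mathbb{N}$ is the set of nonnegative integers. An affine semigroup is a finitely generated submonoid of $(\mathbb{N}^p,+)$, $p\ge 1$ (it contains $0$). Every affine semigroup has a unique minimal generating set (as a monoid); its elements are called its minimal generators. *)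

(* Defs.v *)
From mathcomp Require Import all_boot all_algebra.
From mathcomp Require Import all_classical.

Set Implicit Arguments.
Unset Strict Implicit.
Unset Printing Implicit Defensive.

Import GRing.Theory.
Local Open Scope ring_scope.
Local Open Scope classical_set_scope.

Definition submonoid (V : nmodType) (M : set V) : Prop :=
  GRing.nmod_closed (mem M).

Definition monoid_span (V : nmodType) (G : set V) : set V :=
  smallest (@submonoid V) G.

(* N^p is 'rV[nat]_p; the generating set may be empty, so {0} is affine. *)
Definition affine_semigroup (p : nat) (S : set 'rV[nat]_p) : Prop :=
  exists2 G : set 'rV[nat]_p, finite_set G & S = monoid_span G.

(* Minimality is with respect to inclusion. *)
Definition minimal_generating_set (V : nmodType) (S G : set V) : Prop :=
  S = monoid_span G /\
  forall H : set V, H `<=` G -> S = monoid_span H -> H = G.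

(* Main.v *)
(** In N^p every submonoid M is generated by its atoms (nonzero elements that
    are not sums of two nonzero elements of M), by induction on the sum of the
    coordinates. Conversely, removing an atom from M leaves a submonoid, so every
    generating set contains all atoms. Hence the atoms form the unique
    minimal generating set. Since s_i is an atom of S, S \ {s_i} is a submonoid,
    and it contains the generators of S'; the elements of G are atoms of S, hence
    atoms of the smaller monoid S'. *)
Require Import Defs.
From mathcomp Require Import all_boot all_algebra.
From mathcomp Require Import all_classical.

Set Implicit Arguments.
Unset Strict Implicit.
Unset Printing Implicit Defensive.

Import GRing.Theory.
Local Open Scope ring_scope.
Local Open Scope classical_set_scope.

Lemma submonoidP (V : nmodType) (M : set V) :
  submonoid M <-> M 0 /\ forall x y, M x -> M y -> M (x + y).
Proof.
split=> -[M0 MD]; split.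
- by move: M0; rewrite inE.
- by move=> x y Mx My; move: (MD x y); rewrite !inE; apply.
- by rewrite inE.
- by move=> x y; rewrite !inE; apply: MD.
Qed.

Lemma submonoid_span (V : nmodType) (G : set V) : submonoid (monoid_span G).
Proof.
apply/submonoidP; split=> [N [/submonoidP[]]//|x y Gx Gy N [subN GN]].
by have /submonoidP[_ ND] := subN; apply: ND; [apply: Gx | apply: Gy].
Qed.

Lemma sub_monoid_span (V : nmodType) (G : set V) : G `<=` monoid_span G.
Proof. exact: sub_gen_smallest. Qed.

Lemma monoid_span_sub (V : nmodType) (G M : set V) :
  submonoid M -> G `<=` M -> monoid_span G `<=` M.
Proof. exact: smallest_sub. Qed.

Definition atom (V : nmodType) (M : set V) (a : V) : Prop :=
  [/\ M a, a <> 0 & forall x y, M x -> M y -> a = x + y -> x = 0 \/ y = 0].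

Lemma atom_sub (V : nmodType) (M N : set V) (a : V) :
  N `<=` M -> N a -> atom M a -> atom N a.
Proof. by move=> NM Na [_ a0 aM]; split=> // x y /NM Mx /NM My; apply: aM. Qed.

Lemma submonoidD1 (V : nmodType) (M : set V) (a : V) :
  submonoid M -> atom M a -> submonoid (M `\ a).
Proof.
move=> /submonoidP[M0 MD] [Ma a0 aM]; apply/submonoidP; split=> [|x y].
  by split=> // /esym.
move=> [Mx xa] [My ya]; split; first exact: MD.
move=> /= xya; have [x0|y0] := aM x y Mx My (esym xya).
  by apply: ya; rewrite /= -xya x0 add0r.
by apply: xa; rewrite /= -xya y0 addr0.
Qed.

Lemma atom_generator (V : nmodType) (H : set V) :
  atom (monoid_span H) `<=` H.
Proof.
move=> a aH; apply: contrapT => Ha.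
have /monoid_span_sub sub := submonoidD1 (submonoid_span H) aH.
(* If [H] misses [a], then [H], and hence its span, lies in the span with [a] removed; applying this
   to [a] itself is absurd. *)
have [//|_] := sub H _ a (let: And3 Ma _ _ := aH in Ma).
- by move=> x Hx; split; [exact: sub_monoid_span | move=> /= xa; apply: Ha; rewrite -xa].
- by apply.
Qed.

Lemma monoid_span_atom (p : nat) (M : set 'rV[nat]_p) :
  submonoid M -> M = monoid_span (atom M).
Proof.
move=> subM; apply/seteqP; split; last first.
  by apply: monoid_span_sub => // x [].
have /submonoidP[span0 spanD] := submonoid_span (atom M).
pose wt (x : 'rV[nat]_p) := (\sum_j x ord0 j)%N.
have wtD x y : wt (x + y) = (wt x + wt y)%N.
  by rewrite /wt -big_split; apply: eq_bigr => j _; rewrite mxE.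
have wt_gt0 x : x <> 0 -> (0 < wt x)%N.
  move=> x0; rewrite lt0n; apply/negP; rewrite sum_nat_eq0 => /forallP wx0.
  by apply: x0; apply/rowP => j; rewrite mxE; apply/eqP; exact: wx0.
move=> x; have [n] := ubnP (wt x); elim: n x => // n IHn x ltxn Mx.
have [->//|/eqP x0] := eqVneq x 0.
have [|nax] := pselect (atom M x); first exact: sub_monoid_span.
have [[y [z [My Mz xyz y0 z0]]]|nyz] := pselect (exists y z,
    [/\ M y, M z, x = y + z, y <> 0 & z <> 0]).
  (* Nonzero vectors have positive weight, so both summands are strictly lighter than [x] and the
     induction hypothesis applies to each. *)
  have := ltxn; rewrite xyz wtD ltnS => ltyzn.
  apply: spanD; apply: IHn => //; apply: leq_trans ltyzn.
    by rewrite -[X in (X <= _)%N]addn1 leq_add2l wt_gt0.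
  by rewrite -[X in (X <= _)%N]add1n leq_add2r wt_gt0.
case: nax; split=> // y z My Mz xyz.
apply: contrapT => /not_orP[y0 z0]; apply: nyz.
by exists y, z.
Qed.

Lemma row_nat_addl_eq0 (p : nat) (x y : 'rV[nat]_p) : x + y = 0 -> x = 0.
Proof.
move=> /rowP xy0; apply/rowP => j; move: (xy0 j); rewrite !mxE => /eqP.
by rewrite addn_eq0 => /andP[/eqP].
Qed.

(** The atoms lie in every generating set and already generate [M], so inclusion-minimality leaves
    no other choice. *)
Lemma minimal_generating_set_atom (p : nat) (M G : set 'rV[nat]_p) :
  submonoid M -> minimal_generating_set M G <-> G = atom M.
Proof.
move=> subM; have MA := monoid_span_atom subM; split=> [[MG minG]|->].
  by apply/esym/minG => //; rewrite MG; exact: atom_generator.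
split=> // H HA MH; apply/seteqP; split=> //.
by rewrite MH; exact: atom_generator.
Qed.

Theorem lemma1 (p t : nat) (S S' G : set 'rV[nat]_p)
    (s : 'I_t -> 'rV[nat]_p) (i : 'I_t)
    (hp : (1 <= p)%N)
    (hS : affine_semigroup S)
    (hs : injective s)
    (hmin : minimal_generating_set S (range s))
    (hG : G = [set s j | j in [set~ i]])
    (hS' : S' = monoid_span
       ((G `|` [set s i *+ 2; s i *+ 3]) `|` [set s i + s j | j in [set~ i]])) :
  S' = S `\ s i /\
  exists2 B : set 'rV[nat]_p, unique (minimal_generating_set S') B & G `<=` B.
Proof.
have [Sspan _] := hmin.
have subS : submonoid S by rewrite Sspan; exact: submonoid_span.
have sA : range s = atom S by apply/minimal_generating_set_atom.
have sat j : atom S (s j) by rewrite -sA; exists j.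
have Ss j : S (s j) by have [] := sat j.
have subS' : submonoid S' by rewrite hS'; exact: submonoid_span.
have /submonoidP[S0 SD] := subS; have /submonoidP[S'0 S'D] := subS'.
have [_ s0 si_dec] := sat i.
(* If [s i + x = s i], the atom [s i] would split with two nonzero summands. This keeps all the
   added generators away from [s i]. *)
have Dsi x : S x -> x <> 0 -> (S `\ s i) (s i + x).
  move=> Sx x0; split; first exact: SD.
  by move=> /= /esym; case/(si_dec _ _ (Ss i) Sx).
have S's j : j <> i -> S' (s j).
  by move=> ji; rewrite hS'; apply: sub_monoid_span; left; left; rewrite hG; exists j.
have S'2 : S' (s i *+ 2).
  by rewrite hS'; apply: sub_monoid_span; left; right; left.
have S'3 : S' (s i *+ 3).
  by rewrite hS'; apply: sub_monoid_span; left; right; right.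
have S'is j : j <> i -> S' (s i + s j).
  by move=> ji; rewrite hS'; apply: sub_monoid_span; right; exists j.
have S'E : S' = S `\ s i.
  apply/seteqP; split.
    rewrite hS'; apply: monoid_span_sub; first exact: submonoidD1.
    rewrite hG => x [[[j ji <-]|[->|->]]|[j ji <-]].
    - by split=> // /hs.
    - by rewrite mulr2n; exact: Dsi.
    - rewrite mulrS mulr2n; apply: Dsi; first exact: SD.
      by move=> /row_nat_addl_eq0.
    - by apply: Dsi => //; have [] := sat j.
  (* Key to the inclusion of [S \ {s i}] in [S']: translation by [s i] sends nonzero elements of
     [S'] into [S']. Membership in [S'] is carried along because closure under addition uses
     [s i + (x + y) = (s i + x) + y] with [y] in [S']; the case [x = 0] is split off since [s i]
     itself is to be excluded. *)
  have si_add : S' `<=` [set x | S' x /\ (x = 0 \/ S' (s i + x))].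
    rewrite [X in X `<=` _]hS'; apply: monoid_span_sub => [|x].
      apply/submonoidP; split=> [|x y]; first by split=> //; left.
      move=> [S'x [->|S'ix]] [S'y iy]; first by rewrite add0r.
      by split; [exact: S'D | right; rewrite addrA; exact: S'D].
    rewrite hG => -[[[j ji <-]|[->|->]]|[j ji <-]]; split=> //; try right.
    - exact: S's.
    - exact: S'is.
    - by rewrite -mulrS.
    (* Four copies of [s i] regroup as two plus two. *)
    - by rewrite -mulrS (mulrnDr _ 2 2); exact: S'D.
    - exact: S'is.
    - by rewrite addrA -mulr2n; apply: S'D => //; exact: S's.
  (* Adjoining the single element [s i] to [S'] already gives a submonoid: [s i + s i] is the
     generator [s i *+ 2], and mixed sums are handled by [si_add]. It contains every [s j], hence
     all of [S]. *)
  have S_sub : S `<=` [set x | x = s i \/ S' x].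
    rewrite Sspan; apply: monoid_span_sub => [|_ [j _ <-]]; last first.
      by have [->|/eqP ji] := eqVneq j i; [left | right; exact: S's].
    apply/submonoidP; split=> [|x y]; first by right.
    move=> [->|S'x] [->|S'y]; first by right; rewrite -mulr2n.
    - by have [->|] := (si_add y S'y).2; [left; rewrite addr0 | right].
    - by rewrite addrC; have [->|] := (si_add x S'x).2; [left; rewrite addr0 | right].
    - by right; exact: S'D.
  by move=> x [/S_sub[]].
split=> //; exists (atom S').
  split; first exact/minimal_generating_set_atom.
  by move=> B /minimal_generating_set_atom ->.
rewrite hG => _ [j ji <-]; apply: atom_sub (sat j); last exact: S's.
by rewrite S'E => x [].
Qed.
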